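(* Let $D$ be an oriented knot diagram on $S^2$ with crossing number $c(D)\ge 1$. Let $X_D(t)$ be its warping crossing polynomial and $W_D(t)$ its warping polynomial. Then $$X_D(t)=\frac{W_D(t)}{1+t}.$$
   Context: A knot diagram is a closed curve on $S^2$ with finitely many transverse double points (crossing points), with over/under information at each. $c(D)$ is the number of crossing points. An edge of $D$ is an arc of the curve running between two consecutive passages through crossing points (so there are $2c(D)$ edges when $c(D)\ge 1$). A based diagram $D_b$ is a diagram $D$ with a base point $b$ on $D$ that is not a crossing point. A crossing point of $D$ is a warping crossing point of $D_b$ if, when going along $D$ following its orientation starting from $b$, one meets that crossing point first as an under-crossing. The warping degree $d(D_b)$ is the number of warping crossing points of $D_b$. For an edge $e$ of $D$, $d(e)$ denotes $d(D_b)$ with $b$ any point in the interior of $e$. For a crossing point $c$ of $D$, $d(c)=d(D_b)$ where $b$ is a base point just before the over-crossing of $c$ (with respect to the orientation). The warping crossing polynomial is $X_D(t)=\sum_c t^{d(c)}$, the sum over all crossing points $c$ of $D$. The warping polynomial is $W_D(t)=\sum_e t^{d(e)}$, the sum over all edges $e$ of $D$. *)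

(* Defs.v *)
From HB Require Import structures.
From mathcomp Require Import all_boot all_order all_algebra.
From mathcomp Require Import finmap lra.
From mathcomp Require Import all_classical all_reals all_analysis.

Set Implicit Arguments.
Unset Strict Implicit.
Unset Printing Implicit Defensive.

Import Order.TTheory GRing.Theory Num.Theory.
Import numFieldNormedType.Exports.

Local Open Scope classical_set_scope.
Local Open Scope ring_scope.

(* The circle is R / Z: a closed curve is a 1-periodic map on R, oriented by
   increasing parameter, and a pair s < t < s + 1 is a pair of distinct points
   of the circle. The curve is only required to be continuous, and
   differentiable at its crossing points (where transversality needs it), so
   that smooth and piecewise linear diagrams are both covered. The velocities
   at a crossing point are tangent to S^2, hence they span the tangent plane
   iff they are linearly independent in R^3. The values of [over] matter only
   at the parameters of crossing points. *)
Record knot_diagram (R : realType) := KnotDiagram {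
  curve : R -> 'rV[R]_3 ;
  over : R -> bool ;
  curve_continuous : continuous curve ;
  curve_periodic : forall t, curve (t + 1) = curve t ;
  curve_sphere : forall t, \sum_i curve t ord0 i ^+ 2 = 1 ;
  finite_crossings : finite_set
    [set x | exists s t : R, [/\ s < t < s + 1, curve s = x & curve t = x]] ;
  double_points : forall s t u : R,
    s < t < u -> u < s + 1 -> ~ (curve s = curve t /\ curve t = curve u) ;
  transverse : forall s t : R, s < t < s + 1 -> curve s = curve t ->
    [/\ derivable curve s 1, derivable curve t 1 &
        row_free (col_mx (derive1 curve s) (derive1 curve t))] ;
  over_periodic : forall t, over (t + 1) = over t ;
  over_under : forall s t : R, s < t < s + 1 -> curve s = curve t ->
    over t = ~~ over s }.

Section KnotDiagram.
Variables (R : realType) (D : knot_diagram R).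

Definition crossings : set 'rV[R]_3 :=
  [set x | exists s t : R, [/\ s < t < s + 1, curve D s = x & curve D t = x]].

Definition crossing_number : nat := #|` fset_set crossings|%N.

(* Base points are given by their parameter; [b] is meant to satisfy
   [~ crossings (curve D b)]. *)
Definition warping_crossings (b : R) : set 'rV[R]_3 :=
  [set x | exists s t : R, [/\ b < s < t, t < b + 1, curve D s = x,
                           curve D t = x & ~~ over D s]].

Definition warping_degree (b : R) : nat :=
  #|` fset_set (warping_crossings b)|%N.

(* The interior of the arc between two consecutive passages. *)
Definition edges : set (set 'rV[R]_3) :=
  [set e | exists s t : R, [/\ s < t, crossings (curve D s), crossings (curve D t),
     forall u : R, s < u < t -> ~ crossings (curve D u) &
     e = curve D @` [set u | s < u < t]]].

(* The degree does not depend on the chosen base point, see [edge_degreeE]. *)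
Definition edge_degree (e : set 'rV[R]_3) : nat :=
  warping_degree (get [set b | e (curve D b)]).

Definition just_before_over (c : 'rV[R]_3) : set R :=
  [set b | exists t : R, [/\ b < t, curve D t = c, over D t &
     forall u : R, b <= u < t -> ~ crossings (curve D u)]].

(* The degree does not depend on the chosen base point, see
   [crossing_degreeE]. *)
Definition crossing_degree (c : 'rV[R]_3) : nat :=
  warping_degree (get (just_before_over c)).

Definition warping_crossing_polynomial : {poly int} :=
  \sum_(c \in crossings) ('X^(crossing_degree c) : {poly int}).

Definition warping_polynomial : {poly int} :=
  \sum_(e \in edges) ('X^(edge_degree e) : {poly int}).

End KnotDiagram.

Section WellDefined.
Variables (R : realType) (D : knot_diagram R).
Implicit Types (a b s t u : R) (x c : 'rV[R]_3) (e : set 'rV[R]_3).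

Lemma curveDint t (k : int) : curve D (t + k%:~R) = curve D t.
Proof.
have nat_per u (n : nat) : curve D (u + n%:R) = curve D u.
  by elim: n => [|n IH]; rewrite ?addr0// -natr1 addrA curve_periodic.
case: k => n; first exact: nat_per.
by rewrite NegzE mulrNz -(nat_per _ n.+1) subrK.
Qed.

Lemma overDint t (k : int) : over D (t + k%:~R) = over D t.
Proof.
have nat_per u (n : nat) : over D (u + n%:R) = over D u.
  by elim: n => [|n IH]; rewrite ?addr0// -natr1 addrA over_periodic.
case: k => n; first exact: nat_per.
by rewrite NegzE mulrNz -(nat_per _ n.+1) subrK.
Qed.

Lemma crossings_curveDint t (k : int) :
  crossings D (curve D (t + k%:~R)) = crossings D (curve D t).
Proof. by rewrite curveDint. Qed.

(* Two parameters of the same point differ by an integer, unless they are the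
   two passages through a crossing point. *)
Lemma curve_eqP s t : curve D s = curve D t ->
  exists k : int, let t' := t + k%:~R in
    t' = s \/ [/\ s < t' < s + 1, crossings D (curve D s)
                & over D t = ~~ over D s].
Proof.
move=> st; exists (- Num.floor (t - s)) => /=.
set t' := t + _.
have ct' : curve D s = curve D t' by rewrite /t' curveDint.
have /andP[le1 lt1] : s <= t' < s + 1.
  have := floor_le (t - s); have := floorD1_gt (t - s).
  rewrite /t' intrD mulrNz => ? ?; apply/andP; split; lra.
have := le1; rewrite le_eqVlt => /predU1P[->|lt0]; [by left|right].
have h : s < t' < s + 1 by rewrite lt0.
split=> //; first by exists s, t'.
by rewrite -(over_under h ct') overDint.
Qed.

Lemma warping_crossings_sub a b : a <= b ->
  (forall u, a <= u <= b -> ~ crossings D (curve D u)) ->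
  warping_crossings D a = warping_crossings D b.
Proof.
move=> ab nc; apply/seteqP; split => x /= [s [t [/andP[h1 h2] h3 h4 h5 h6]]].
- exists s, t; split=> //; last lra.
  rewrite h2 andbT ltNge; apply/negP => sb.
  apply: (nc s); first by rewrite sb andbT ltW.
  by exists s, t; split=> //; [apply/andP; split; lra | rewrite h5].
- exists s, t; split=> //; first by rewrite h2 andbT; lra.
  rewrite ltNge; apply/negP => ta.
  have tE : t - 1 = t + (-1)%:~R by rewrite mulrN1z.
  apply: (nc (t - 1)); first by apply/andP; split; lra.
  rewrite tE crossings_curveDint; exists s, t; split=> //; last by rewrite h4.
  by apply/andP; split; lra.
Qed.

Lemma warping_degreeDint b (k : int) :
  warping_degree D (b + k%:~R) = warping_degree D b.
Proof.
rewrite /warping_degree; congr (size (fset_set _)).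
have sub a (j : int) :
    warping_crossings D a `<=` warping_crossings D (a + j%:~R).
  move=> x [s [t [/andP[h1 h2] h3 h4 h5 h6]]].
  exists (s + j%:~R), (t + j%:~R); rewrite !curveDint overDint.
  by split=> //; [apply/andP; split|]; lra.
apply/seteqP; split; last exact: sub.
by have := sub (b + k%:~R) (- k); rewrite mulrNz addrK.
Qed.

Lemma warping_degree_const a b :
  (forall u, a <= u <= b \/ b <= u <= a -> ~ crossings D (curve D u)) ->
  warping_degree D a = warping_degree D b.
Proof.
move=> nc; rewrite /warping_degree.
have [ab|ba] := leP a b.
  by rewrite (warping_crossings_sub ab) // => u hu; apply: nc; left.
by rewrite (warping_crossings_sub (ltW ba)) // => u hu; apply: nc; right.
Qed.

Lemma edge_degreeE e b : edges D e -> e (curve D b) ->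
  edge_degree D e = warping_degree D b.
Proof.
move=> [s [t [st _ _ nc eE]]] eb; rewrite /edge_degree.
set b' := get _.
have eb' : e (curve D b') by apply: (@getPex _ [set b | e (curve D b)]); exists b.
have red a : e (curve D a) ->
    exists2 v, s < v < t & warping_degree D a = warping_degree D v.
  rewrite eE => -[v /= hv vE]; exists v => //.
  have [k /= [ak|[_ + _]]] := curve_eqP vE; last by move/(nc _ hv).
  by rewrite -ak warping_degreeDint.
have [v /andP[v1 v2] ->] := red _ eb'.
have [w /andP[w1 w2] ->] := red _ eb.
apply: warping_degree_const => u hu; apply: nc.
by case: hu => /andP[u1 u2]; apply/andP; split; lra.
Qed.

Lemma crossing_degreeE c b : crossings D c -> just_before_over D c b ->
  crossing_degree D c = warping_degree D b.
Proof.
move=> cc jb; rewrite /crossing_degree.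
set b' := get _.
have : just_before_over D c b' by apply: (@getPex _ (just_before_over D c)); exists b.
case: jb => t [bt ct ot nct] [t' [bt' ct' ot' nct']].
have tt' : curve D t = curve D t' by rewrite ct.
have [k /= [tk|[_ _]]] := curve_eqP tt'; last by rewrite ot ot'.
rewrite -(warping_degreeDint b' k).
apply: warping_degree_const => u [] /andP[u1 u2].
  rewrite -(crossings_curveDint u (- k)) mulrNz; apply: nct'.
  by apply/andP; split; lra.
by apply: nct; apply/andP; split; lra.
Qed.

Lemma finite_passages :
  finite_set [set t | 0 <= t < 1 /\ crossings D (curve D t)].
Proof.
have -> : [set t | 0 <= t < 1 /\ crossings D (curve D t)] =
    \bigcup_(x in crossings D) [set t | 0 <= t < 1 /\ curve D t = x].
  apply/seteqP; split=> t /=; first by case=> ? ?; exists (curve D t).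
  by case=> x cx [? tx]; rewrite tx.
apply: bigcup_finite; first exact: finite_crossings.
move=> x _; set P := [set t | _].
have [[s [t [st Ps Pt]]]|h] := pselect (exists s t : R, [/\ s < t, P s & P t]).
  apply: (@sub_finite_set _ _ [set s; t]); last exact: finite_set2.
  move: Ps Pt => [/andP[s0 s1] sx] [/andP[t0 t1] tx] u [/andP[u0 u1] ux] /=.
  have [us|us|->] := ltgtP u s; [| |by left].
    exfalso; apply: (@double_points _ D u s t); [by rewrite us|lra|].
    by rewrite ux sx tx.
  have [ut|ut|->] := ltgtP u t; [| |by right].
    exfalso; apply: (@double_points _ D s u t); [by rewrite us|lra|].
    by rewrite ux sx tx.
  exfalso; apply: (@double_points _ D s t u); [by rewrite st|lra|].
  by rewrite ux sx tx.
have [->|/set0P[s Ps]] := eqVneq P set0; first exact: finite_set0.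
apply: (@sub_finite_set _ _ [set s]); last exact: finite_set1.
move=> u Pu /=; have [us|us|//] := ltgtP u s; exfalso; apply: h.
  by exists u, s.
by exists s, u.
Qed.

Lemma just_before_over_ex c : crossings D c ->
  exists b, just_before_over D c b.
Proof.
move=> cc; have [t ot tc] : exists2 t, over D t & curve D t = c.
  have [s [t [st sc tc]]] := cc.
  case os : (over D s); first by exists s.
  by exists t; rewrite // (over_under st) ?os // sc.
pose Q := [set u | t - 1 <= u < t /\ crossings D (curve D u)].
pose P := [set u | 0 <= u < 1 /\ crossings D (curve D u)].
pose k := Num.floor (t - 1).
have finQ : finite_set Q.
  apply: (@sub_finite_set _ _ ((fun v => v + k%:~R) @` P `|`
      (fun v => v + (k + 1)%:~R) @` P)); last first.
    by rewrite finite_setU; split; exact: finite_image finite_passages.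
  move=> u [/andP[u1 u2] cu].
  have := floor_le (t - 1); have := floorD1_gt (t - 1).
  rewrite -/k intrD => k1 k2.
  have [uk|uk] := ltP u (k%:~R + 1).
    left; exists (u - k%:~R); last by rewrite /= subrK.
    split; first by apply/andP; split; lra.
    by rewrite -mulrNz crossings_curveDint.
  right; exists (u - (k + 1)%:~R); last by rewrite intrD subrK.
  split; first by rewrite intrD; apply/andP; split; lra.
  by rewrite -mulrNz crossings_curveDint.
have [r Qr] : exists r : seq R, Q = [set` r] by apply/finite_seqP.
have [m mt mQ] : exists2 m, m < t & forall u, u \in r -> u <= m.
  have : forall u, u \in r -> u < t.
    by move=> u ur; have : Q u; [rewrite Qr|case=> /andP[]].
  elim: r {Qr} => [|v r IH] h; first by exists (t - 1) => //; lra.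
  have [u ur|m mt mr] := IH; first by apply: h; rewrite inE ur orbT.
  exists (Num.max v m); first by rewrite gt_max mt h ?mem_head.
  move=> u; rewrite inE le_max => /predU1P[->|/mr ->]; first by rewrite lexx.
  by rewrite orbT.
pose m' := Num.max m (t - 1).
have [m'1 m'2 m't] : [/\ m <= m', t - 1 <= m' & m' < t].
  by rewrite /m' !le_max !lexx orbT gt_max mt; split=> //=; lra.
exists ((m' + t) / 2), t; split=> //; first lra.
move=> u /andP[u1 u2] cu.
have : Q u by split=> //; apply/andP; split; lra.
by rewrite Qr => /mQ; lra.
Qed.

Lemma finite_edges : finite_set (edges D).
Proof.
pose E (s : R) (e : set 'rV[R]_3) := exists t : R, [/\ s < t, crossings D (curve D t),
     forall u : R, s < u < t -> ~ crossings D (curve D u) &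
     e = curve D @` [set u | s < u < t]].
have E_inj s e e' : E s e -> E s e' -> e = e'.
  move=> [t [st ct nt ->]] [t' [st' ct' nt' ->]].
  have -> // : t = t'.
  have [tt'|tt'|//] := ltgtP t t'; exfalso.
    by apply: (nt' t) => //; rewrite st.
  by apply: (nt t') => //; rewrite st'.
apply: (@sub_finite_set _ _ ((fun s => get (E s)) @`
    [set t | 0 <= t < 1 /\ crossings D (curve D t)])); last first.
  exact: (finite_image _ finite_passages).
move=> e [s [t [st cs ct nc eE]]] /=.
pose k := - Num.floor s.
have Es : E (s + k%:~R) e.
  exists (t + k%:~R); split; [lra|by rewrite crossings_curveDint| |].
    move=> u /andP[u1 u2]; rewrite -(crossings_curveDint u (- k)) mulrNz.
    by apply: nc; apply/andP; split; lra.
  rewrite eE; apply/seteqP; split=> _ /= [u /andP[u1 u2] <-].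
    exists (u + k%:~R); last exact: curveDint.
    by apply/andP; split; lra.
  exists (u - k%:~R); last by rewrite -mulrNz curveDint.
  by apply/andP; split; lra.
exists (s + k%:~R).
  split; last by rewrite crossings_curveDint.
  have := floor_le s; have := floorD1_gt s.
  by rewrite /k intrD mulrNz => ? ?; apply/andP; split; lra.
by apply: (E_inj (s + k%:~R)) => //; apply: (@getPex _ (E _)); exists e.
Qed.

End WellDefined.

(* Main.v *)
Require Import Defs.
From HB Require Import structures.
From mathcomp Require Import all_boot all_order all_algebra.
From mathcomp Require Import finmap zify lra ring.
From mathcomp Require Import all_classical all_reals all_analysis.

Set Implicit Arguments.
Unset Strict Implicit.
Unset Printing Implicit Defensive.

Import Order.TTheory GRing.Theory Num.Theory.
Local Open Scope ring_scope.

(* Moving the base point across a passage raises the warping degree by one if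
   the passage is over, and lowers it by one if it is under. Every edge ends at
   exactly one passage and starts at exactly one passage; summing [t^d(e)] along
   these two enumerations gives [W = X + t U] and [W = t X + U], where [U] is
   the sum of [t^d] over the edges starting at an under-passage. Hence
   [(1 - t) X = (1 - t) U], so [X = U] and [W = (1 + t) X]. *)

Lemma seq_argmax (T : eqType) (R : realDomainType) (f : T -> R) (r : seq T) :
  r != [::] -> exists2 m, m \in r & {in r, forall u, f u <= f m}.
Proof.
elim: r => // v r IH _; have [->|/IH[m mr mM]] := eqVneq r [::].
  by exists v; [rewrite mem_head|move=> u; rewrite inE => /eqP->].
have [fvm|fmv] := leP (f v) (f m).
  exists m; first by rewrite inE mr orbT.
  by move=> u; rewrite inE => /predU1P[->//|/mM].
exists v; first exact: mem_head.
by move=> u; rewrite inE => /predU1P[->//|/mM/le_trans]; apply; exact: ltW.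
Qed.

Lemma subr_floor_itv (R : realType) (t : R) :
  0 <= t + (- Num.floor t)%:~R < 1.
Proof.
have := floor_le t; have := floorD1_gt t.
by rewrite intrD mulrNz => ? ?; apply/andP; split; lra.
Qed.

Lemma itv01_shift (R : realType) (s t : R) (k : int) :
  0 <= s < 1 -> 0 <= t < 1 -> t + k%:~R = s -> t = s.
Proof.
move=> /andP[s0 s1] /andP[t0 t1] tks.
have k1 : (k < 1)%R by rewrite -(@ltr_int R); lra.
have k0 : (-1 < k)%R by rewrite -(@ltr_int R) mulrN1z; lra.
have k_eq0 : k = 0 by lia.
by rewrite -tks k_eq0 addr0.
Qed.

Section Passages.
Local Open Scope classical_set_scope.
Variables (R : realType) (D : knot_diagram R).
Implicit Types (a b p q s t u : R) (x c : 'rV[R]_3) (e : set 'rV[R]_3).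

(** * Passages through crossing points and the gaps between them *)

Definition passage t := crossings D (curve D t).

Definition consecutive s t :=
  [/\ s < t, passage s, passage t & forall u, s < u < t -> ~ passage u].

Definition arc s t : set 'rV[R]_3 := curve D @` [set u | s < u < t].

Lemma passageDint t (k : int) : passage (t + k%:~R) = passage t.
Proof. exact: crossings_curveDint. Qed.

Lemma other_passage p : passage p ->
  exists2 q, p < q < p + 1 & curve D q = curve D p.
Proof.
move=> [s [t [/andP[st ts] sp tp]]].
have [k /= [ks|[/andP[k1 k2] _ _]]] := curve_eqP sp.
  exists (t - k%:~R); first by apply/andP; split; lra.
  by rewrite -mulrNz curveDint.
(* Here [p + k] lies after [s] within one period, so the next visit is that of [s] one turn later,
   translated back by [k]. *)
exists (s + (1 - k)%:~R); last by rewrite curveDint.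
by rewrite intrD mulrNz; apply/andP; split; lra.
Qed.

(** Finiteness is carried over from the window [[0, 1)]: subtracting the floor of [v - a] sends each
    representative [v] back to the window after [a]. *)
Lemma finite_passages_itv a : finite_set [set t | a < t < a + 1 /\ passage t].
Proof.
apply: (@sub_finite_set _ _ ((fun v => v - (Num.floor (v - a))%:~R) @`
    [set t | 0 <= t < 1 /\ passage t])); last first.
  exact: (finite_image _ (finite_passages D)).
move=> u [/andP[au ua] pu] /=; exists (u + (- Num.floor u)%:~R).
  by split; [exact: subr_floor_itv|rewrite passageDint].
have -> : Num.floor (u + (- Num.floor u)%:~R - a) = - Num.floor u.
  by apply: floor_def; rewrite intrD; apply/andP; split; lra.
by rewrite addrK.
Qed.

(** With [f] the identity this yields the last passage of the open window, with [f] the opposite the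
    first one. The window is not empty because the other visit to the crossing point at [a] falls
    strictly inside it. *)
Lemma passage_argmax (f : R -> R) a : passage a ->
  exists m, [/\ a < m < a + 1, passage m &
    forall u, a < u < a + 1 -> passage u -> f u <= f m].
Proof.
move=> pa; have /finite_seqP[r rE] := finite_passages_itv a.
have rP u : (u \in r) <-> a < u < a + 1 /\ passage u.
  by have /= := congr1 (fun A => A u) rE => ->.
have r0 : r != [::].
  have [q aq qa] := other_passage pa.
  have : q \in r by apply/rP; split=> //; rewrite /passage qa.
  by case: (r).
have [m /rP[am pm] mM] := seq_argmax f r0.
by exists m; split=> // u au pu; apply: mM; apply/rP.
Qed.

Lemma next_passage p : passage p -> exists u, consecutive p u.
Proof.
move=> pp; have [m [/andP[m1 m2] pm mM]] := passage_argmax -%R pp.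
exists m; split=> // u /andP[u1 u2] pu.
by have := mM u _ pu; rewrite lerN2 leNgt u2 u1 (lt_trans u2 m2) => /(_ isT).
Qed.

Lemma prev_passage p : passage p -> exists s, consecutive s p.
Proof.
(* The window starts one turn earlier so that it ends at [p]. *)
move=> pp; have pp1 : passage (p - 1) by rewrite -(mulrN1z 1) passageDint.
have [m [/andP[m1 m2] pm mM]] := passage_argmax id pp1.
rewrite subrK in m2 mM.
exists m; split=> // u /andP[u1 u2] pu.
by have := mM u _ pu; rewrite /= leNgt u1 u2 (lt_trans m1 u1) => /(_ isT).
Qed.

Lemma consecutive_injl s s' t : consecutive s t -> consecutive s' t -> s = s'.
Proof.
move=> [st ps _ nc] [st' ps' _ nc']; have [ss'|ss'|//] := ltgtP s s'; exfalso.
  by apply: (nc s'); rewrite ?ss'.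
by apply: (nc' s); rewrite ?ss'.
Qed.

Lemma consecutive_injr s t t' : consecutive s t -> consecutive s t' -> t = t'.
Proof.
move=> [st _ pt nc] [st' _ pt' nc']; have [tt'|tt'|//] := ltgtP t t'; exfalso.
  by apply: (nc' t); rewrite ?st.
by apply: (nc t'); rewrite ?st'.
Qed.

Lemma consecutiveDint s t (k : int) :
  consecutive s t -> consecutive (s + k%:~R) (t + k%:~R).
Proof.
move=> [st ps pt nc]; split; rewrite ?passageDint ?ltrD2r// => u /andP[u1 u2].
rewrite -(passageDint u (- k)) mulrNz.
by apply: nc; apply/andP; split; lra.
Qed.

Lemma arcDint s t (k : int) : arc (s + k%:~R) (t + k%:~R) = arc s t.
Proof.
apply/seteqP; split=> _ /= [u /andP[u1 u2] <-].
  exists (u - k%:~R); last by rewrite -mulrNz curveDint.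
  by apply/andP; split; lra.
exists (u + k%:~R); last exact: curveDint.
by apply/andP; split; lra.
Qed.

Lemma edgesP e : edges D e <-> exists s t, consecutive s t /\ e = arc s t.
Proof.
split=> [[s [t [st ps pt nc eE]]]|[s [t [[st ps pt nc] eE]]]].
  by exists s, t.
by exists s, t; split.
Qed.

(** An interior point of an edge is not a crossing point, so its parameter is unique up to an
    integer. After translation the two parameter intervals therefore overlap, and overlapping gaps
    between consecutive passages coincide. *)
Lemma arc_inj s t s' t' : consecutive s t -> consecutive s' t' ->
  arc s t = arc s' t' -> exists k : int, s' + k%:~R = s /\ t' + k%:~R = t.
Proof.
move=> cst cst' eA; have [st ps pt nc] := cst.
pose v := (s + t) / 2.
have hv : s < v < t by rewrite /v; apply/andP; split; lra.
have : arc s t (curve D v) by exists v.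
rewrite eA => -[w /= /andP[w1 w2] wv].
have [k /= [wk|[_ + _]]] := curve_eqP (esym wv); last by move=> /(nc _ hv).
exists k; have [st' ps' pt' nc'] := consecutiveDint k cst'.
move: hv => /andP[v1 v2]; split.
  have [h|h|//] := ltgtP (s' + k%:~R) s; exfalso.
    by apply: (nc' s) => //; rewrite h /=; lra.
  by apply: (nc (s' + k%:~R)) => //; rewrite h /=; lra.
have [h|h|//] := ltgtP (t' + k%:~R) t; exfalso.
  by apply: (nc (t' + k%:~R)) => //; rewrite h andbT; lra.
by apply: (nc' t) => //; rewrite h andbT; lra.
Qed.

(** * Enumerations of edges and crossing points by passages *)

Definition edge_to p := get [set e | exists2 s, consecutive s p & e = arc s p].

Definition edge_from p := get [set e | exists2 u, consecutive p u & e = arc p u].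

Lemma edge_toE s p : consecutive s p -> edge_to p = arc s p.
Proof.
move=> cs; rewrite /edge_to.
have [|s' cs' ->] :=
    @getPex _ [set e | exists2 s, consecutive s p & e = arc s p].
  by exists (arc s p), s.
by rewrite (consecutive_injl cs cs').
Qed.

Lemma edge_fromE p u : consecutive p u -> edge_from p = arc p u.
Proof.
move=> cu; rewrite /edge_from.
have [|u' cu' ->] :=
    @getPex _ [set e | exists2 u, consecutive p u & e = arc p u].
  by exists (arc p u), u.
by rewrite (consecutive_injr cu cu').
Qed.

Lemma edge_degree_arc s t b : consecutive s t -> s < b < t ->
  edge_degree D (arc s t) = warping_degree D b.
Proof.
move=> cst sbt; apply: edge_degreeE; last by exists b.
by apply/edgesP; exists s, t.
Qed.

Definition passages01 := [set t | 0 <= t < 1 /\ passage t].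

(** Edges with the same image have end parameters differing by an integer, hence equal in [[0, 1)];
    conversely any edge can be translated so that its end lies there. *)
Lemma edge_to_bij : set_bij passages01 (edges D) edge_to.
Proof.
split.
- move=> p [_ /prev_passage[s cs]].
  by rewrite /= (edge_toE cs); apply/edgesP; exists s, p.
- move=> p q /set_mem[p01 pp] /set_mem[q01 pq].
  have [[s cs] [s' cs']] := (prev_passage pp, prev_passage pq).
  rewrite (edge_toE cs) (edge_toE cs') => /(arc_inj cs cs')[k [_ kq]].
  by rewrite -(itv01_shift p01 q01 kq).
- move=> e /edgesP[s [t [cst ->]]].
  have cst' := consecutiveDint (- Num.floor t) cst.
  exists (t + (- Num.floor t)%:~R); last by rewrite (edge_toE cst') arcDint.
  by split; [exact: subr_floor_itv|case: cst'].
Qed.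

Lemma edge_from_bij : set_bij passages01 (edges D) edge_from.
Proof.
split.
- move=> p [_ /next_passage[u cu]].
  by rewrite /= (edge_fromE cu); apply/edgesP; exists p, u.
- move=> p q /set_mem[p01 pp] /set_mem[q01 pq].
  have [[u cu] [u' cu']] := (next_passage pp, next_passage pq).
  rewrite (edge_fromE cu) (edge_fromE cu') => /(arc_inj cu cu')[k [kq _]].
  by rewrite -(itv01_shift p01 q01 kq).
- move=> e /edgesP[s [t [cst ->]]].
  have cst' := consecutiveDint (- Num.floor s) cst.
  exists (s + (- Num.floor s)%:~R); last by rewrite (edge_fromE cst') arcDint.
  by split; [exact: subr_floor_itv|case: cst'].
Qed.

(** The two visits to a crossing point have opposite [over] values, so exactly one per turn is over.
    This turns the sum over crossing points into a sum over over-passages. *)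
Lemma over_passage_bij :
  set_bij (passages01 `&` [set t | Defs.over D t]) (crossings D) (curve D).
Proof.
split.
- by move=> p [[]].
- move=> p q /set_mem[[p01 _] op] /set_mem[[q01 _] oq] pq.
  have [k /= [kq|[_ _]]] := curve_eqP pq; first by rewrite (itv01_shift p01 q01 kq).
  by rewrite op oq.
- move=> c cc; have [b [t [_ tc ot _]]] := just_before_over_ex cc.
  exists (t + (- Num.floor t)%:~R); last by rewrite /= curveDint.
  split; last by rewrite /= overDint.
  by split; [exact: subr_floor_itv|rewrite passageDint /passage tc].
Qed.

(** A base point just before an over-passage lies on the edge that ends there. *)
Lemma crossing_degree_edge_to p : passage p -> Defs.over D p ->
  crossing_degree D (curve D p) = edge_degree D (edge_to p).
Proof.
move=> pp op; have [s cs] := prev_passage pp; have [sp _ _ nc] := cs.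
pose b := (s + p) / 2.
have [sb bp] : s < b /\ b < p by rewrite /b; split; lra.
rewrite (edge_toE cs) (edge_degree_arc (b := b) cs) ?sb//.
apply: crossing_degreeE => //; exists p; split=> // u /andP[bu up].
by apply: nc; rewrite up andbT (lt_le_trans sb bu).
Qed.

(** * Change of the warping degree across one passage *)

Lemma warping_crossings_first b s t : b < s < t -> t < b + 1 ->
  curve D s = curve D t ->
  warping_crossings D b (curve D s) <-> ~~ Defs.over D s.
Proof.
move=> /andP[bs st] tb sE; split=> [|os]; last first.
  by exists s, t; split; rewrite // bs.
move=> [s' [t' [/andP[bs' st'] tb' s'E t'E os']]].
(* A different first visit [s'] would make three visits to one point within a period, contradicting
   [double_points]. *)
have [ss'|ss'|->//] := ltgtP s s'; exfalso.
  apply: (@double_points _ D s s' t'); [by rewrite ss'|lra|].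
  by rewrite s'E t'E.
apply: (@double_points _ D s' s t); [by rewrite ss'|lra|].
by rewrite s'E -sE.
Qed.

Lemma warping_crossings_before b p b' : b < p < b' -> passage p ->
  (forall u, b <= u <= b' -> passage u -> u = p) ->
  warping_crossings D b (curve D p) <-> ~~ Defs.over D p.
Proof.
move=> /andP[bp pb'] pp only_p.
have [q /andP[pq qp1] qp] := other_passage pp.
apply: (@warping_crossings_first b p q); rewrite ?bp//.
(* If [q] came after [b + 1], then [q - 1] would be a second passage between [b] and [b']. *)
rewrite ltNge; apply/negP => bq; have : q + (-1)%:~R = p.
  apply: only_p; last by rewrite passageDint /passage qp.
  by rewrite mulrN1z; apply/andP; split; lra.
by rewrite mulrN1z; lra.
Qed.

(** Seen from [b'], the visit at [p] only recurs at [p + 1], so the other visit [q] comes first, and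
    it is under exactly when [p] is over. *)
Lemma warping_crossings_after b p b' : b < p < b' -> b' < b + 1 -> passage p ->
  (forall u, b <= u <= b' -> passage u -> u = p) ->
  warping_crossings D b' (curve D p) <-> Defs.over D p.
Proof.
move=> /andP[bp pb'] b'b pp only_p.
have [q /andP[pq qp1] qp] := other_passage pp.
have b'q : b' < q.
  rewrite ltNge; apply/negP => qb'; have : q = p.
    by apply: only_p; [apply/andP; split; lra|rewrite /passage qp].
  by move=> qE; move: pq; rewrite qE ltxx.
have -> : Defs.over D p = ~~ Defs.over D q.
  by rewrite (@over_under _ D p q) ?negbK ?qp// pq.
rewrite -qp; apply: (@warping_crossings_first b' q (p + 1)); first by rewrite b'q.
  by rewrite ltrD2r.
by rewrite curve_periodic.
Qed.

(** The order of the two visits could only change if one of them, up to a turn, lay between [b] and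
    [b']; it would then be [p]. *)
Lemma warping_crossings_other b p b' x : b < p < b' -> b' < b + 1 ->
  (forall u, b <= u <= b' -> passage u -> u = p) ->
  x <> curve D p ->
  warping_crossings D b x <-> warping_crossings D b' x.
Proof.
move=> /andP[bp pb'] b'b only_p xp; split=> -[s [t [/andP[bs st] tb sx tx us]]];
  exists s, t; split=> //.
- rewrite st andbT ltNge; apply/negP => sb'; apply: xp.
  rewrite -sx; congr curve; apply: only_p; first by rewrite (ltW bs).
  by exists s, t; split; [apply/andP; split; lra| |rewrite tx].
- lra.
- by rewrite st andbT; lra.
- rewrite ltNge; apply/negP => bt; apply: xp.
  rewrite -tx -(curveDint D t (-1)); congr curve; apply: only_p.
    by rewrite mulrN1z; apply/andP; split; lra.
  rewrite passageDint.
  by exists s, t; split; [apply/andP; split; lra|rewrite sx|].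
Qed.

Lemma finite_warping_crossings b : finite_set (warping_crossings D b).
Proof.
apply: sub_finite_set (finite_crossings D) => x [s [t [/andP[bs st] tb sx tx _]]].
by exists s, t; split=> //; apply/andP; split; lra.
Qed.

(** The order of [b] and [b'] is left free, so this serves both the rise at an over-passage and the
    fall at an under-passage. *)
Lemma warping_degreeS x b b' : ~ warping_crossings D b x ->
  warping_crossings D b' x ->
  (forall y, y <> x -> warping_crossings D b y <-> warping_crossings D b' y) ->
  warping_degree D b' = (warping_degree D b).+1.
Proof.
move=> nbx b'x bb'.
have -> : warping_degree D b' = #|` fset_set (x |` warping_crossings D b)|%N.
  rewrite /warping_degree; congr (size (fset_set _)).
  apply/seteqP; split=> y; have [->|/eqP yx] := eqVneq y x.
  - by left.
  - by right; apply/bb'.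
  - by [].
  - by case=> // /bb'; apply.
rewrite fset_setU1; last exact: finite_warping_crossings.
rewrite cardfsU1 in_fset_set; last exact: finite_warping_crossings.
by rewrite memNset.
Qed.

Lemma edge_degree_pass p : passage p ->
  if Defs.over D p then edge_degree D (edge_from p) = (edge_degree D (edge_to p)).+1
  else edge_degree D (edge_to p) = (edge_degree D (edge_from p)).+1.
Proof.
move=> pp; have [[s cs] [u cu]] := (prev_passage pp, next_passage pp).
rewrite (edge_toE cs) (edge_fromE cu).
have [sp _ _ nsp] := cs; have [pu _ _ npu] := cu.
have sp1 : p - 1 <= s.
  rewrite leNgt; apply/negP => sp1; apply: (nsp (p + (-1)%:~R)).
    by rewrite mulrN1z sp1 /=; lra.
  by rewrite passageDint.
have up1 : u <= p + 1.
  rewrite leNgt; apply/negP => up1; apply: (npu (p + 1%:~R)).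
    by rewrite up1 andbT; lra.
  by rewrite passageDint.
(* Since [u - s] can reach [2], midpoints could be a full turn apart; these points differ by
   [(u - s) / 3], which is less than [1]. *)
pose b := (s + 2 * p) / 3; pose b' := (2 * p + u) / 3.
have [sb bp] : s < b /\ b < p by rewrite /b; split; lra.
have [pb' b'u] : p < b' /\ b' < u by rewrite /b'; split; lra.
have b'b : b' < b + 1 by rewrite /b /b'; lra.
have only_p v : b <= v <= b' -> passage v -> v = p.
  move=> /andP[bv vb'] pv; have [vp|pv'|//] := ltgtP v p; exfalso.
    by apply: (nsp v) => //; rewrite vp andbT (lt_le_trans sb bv).
  by apply: (npu v) => //; rewrite pv' (le_lt_trans vb' b'u).
rewrite (edge_degree_arc (b := b) cs) ?sb// (edge_degree_arc (b := b') cu) ?pb'//.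
have bpb' : b < p < b' by rewrite bp.
have wb := warping_crossings_before bpb' pp only_p.
have wb' := warping_crossings_after bpb' b'b pp only_p.
have wo y := @warping_crossings_other b p b' y bpb' b'b only_p.
case: ifPn => op.
  by apply: (@warping_degreeS (curve D p)) => //; [move/wb; rewrite op|exact/wb'].
apply: (@warping_degreeS (curve D p)) => [||y /wo[]//].
  by move/wb'; rewrite (negbTE op).
exact/wb.
Qed.

(** * The identity between the two polynomials *)

Lemma warping_polynomialE :
  warping_polynomial D = (1 + 'X) * warping_crossing_polynomial D.
Proof.
pose f p : {poly int} := 'X^(edge_degree D (edge_to p)).
pose g p : {poly int} := 'X^(edge_degree D (edge_from p)).
have fin : finite_set passages01 := finite_passages D.
pose r := fset_set passages01.
have rP p : p \in r -> passage p by rewrite in_fset_set// => /set_mem[].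
have Wf : warping_polynomial D = \sum_(p <- r) f p.
  by rewrite /warping_polynomial (reindex_fsbig edge_to passages01) ?fsbig_finite//;
     exact: edge_to_bij.
have Wg : warping_polynomial D = \sum_(p <- r) g p.
  by rewrite /warping_polynomial (reindex_fsbig edge_from passages01) ?fsbig_finite//;
     exact: edge_from_bij.
have XE : warping_crossing_polynomial D = \sum_(p <- r | Defs.over D p) f p.
  rewrite /warping_crossing_polynomial.
  rewrite (reindex_fsbig (curve D) (passages01 `&` [set t | Defs.over D t])); last first.
    exact: over_passage_bij.
  rewrite fsbig_mkcondr fsbig_finite// [RHS]big_mkcond.
  apply: eq_big_seq => p /rP pp; case: ifPn => [/set_mem/= op|].
    by rewrite op crossing_degree_edge_to.
  by move/negP => nop; rewrite ifN//; apply/negP => op; apply: nop; exact/mem_set.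
pose U := \sum_(p <- r | ~~ Defs.over D p) g p.
have WfE : warping_polynomial D = warping_crossing_polynomial D + 'X * U.
  rewrite Wf (bigID (Defs.over D)) XE /=; congr (_ + _).
  rewrite /U mulr_sumr [LHS]big_seq_cond [RHS]big_seq_cond.
  apply: eq_bigr => p /andP[/rP pp /negbTE op].
  by have := edge_degree_pass pp; rewrite op /f => ->; rewrite exprS.
have WgE : warping_polynomial D = 'X * warping_crossing_polynomial D + U.
  rewrite Wg (bigID (Defs.over D)) XE /=; congr (_ + _).
  rewrite mulr_sumr [LHS]big_seq_cond [RHS]big_seq_cond.
  apply: eq_bigr => p /andP[/rP pp op].
  by have := edge_degree_pass pp; rewrite op /g => ->; rewrite exprS.
have X1 : 'X - 1 != 0 :> {poly int} by rewrite -polyC1 polyXsubC_eq0.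
have cancel (X V : {poly int}) : X + 'X * V = 'X * X + V -> X = V.
  move=> XV; apply: (mulfI X1).
  (* Adding the two equal sides of [XV] to the two members of [('X - 1) * X = ('X - 1) * V] turns
     both into ['X * X + 'X * V]. *)
  by apply: (addIr (X + 'X * V)); rewrite {2}XV; ring.
have XU : warping_crossing_polynomial D = U by apply: cancel; rewrite -WfE.
by rewrite WfE XU mulrDl mul1r.
Qed.

End Passages.

Theorem theorem1p2 (R : realType) (D : knot_diagram R) :
  (1 <= crossing_number D)%N ->
  tofrac (warping_crossing_polynomial D) =
    tofrac (warping_polynomial D) / tofrac (1 + 'X)
    :> {fraction {poly int}}.
Proof.
move=> _; rewrite warping_polynomialE tofracM mulrC mulKf//.
(* The denominator is nonzero, being ['X - c%:P] with [c = -1]. *)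
by rewrite tofrac_eq0 addrC -polyC1 -(opprK 1%:P) -polyCN polyXsubC_eq0.
Qed.
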